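(* Let $\vec\omega\in\mathbb R^3$ be a constant nonzero vector with $\omega=\|\vec\omega\|$, let $\omega_0>0$ and $\vec r_0,\vec v_0\in\mathbb R^3$. The solution of the Cauchy problem $$\ddot{\vec r}+2\vec\omega\times\dot{\vec r}+\omega_0^2\vec r=\vec 0,\qquad \vec r(0)=\vec r_0,\quad\dot{\vec r}(0)=\vec v_0,$$ is $$\vec r=\frac{\vec\omega\cdot\vec\psi_0}{\omega^2}\vec\omega-\frac{\sin(\omega t)}{\omega}\,\vec\omega\times\vec\psi_*-\frac{\cos(\omega t)}{\omega^2}\,\vec\omega\times(\vec\omega\times\vec\psi_* ),$$ where $$\vec\psi_0=\vec r_0\cos(\omega_0t)+\frac{\vec v_0+\vec\omega\times\vec r_0}{\omega_0}\sin(\omega_0t),$$ $$\vec\psi_*=\vec r_0\cos(\omega_*t)+\frac{\vec v_0+\vec\omega\times\vec r_0}{\omega_*}\sin(\omega_*t),\qquad \omega_*^2=\omega^2+\omega_0^2 .$$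
   Context: Vectors are in oriented Euclidean three-space; $\times$ is the cross product, $\cdot$ the scalar product, the dot over a symbol denotes $d/dt$; $\omega_*>0$. *)

(* Defs.v *)
From HB Require Import structures.
From mathcomp Require Import all_boot all_order all_algebra.
From mathcomp Require Import all_classical all_reals all_analysis.
Set Implicit Arguments.
Unset Strict Implicit.
Unset Printing Implicit Defensive.
Import Order.TTheory GRing.Theory Num.Theory.
Import numFieldNormedType.Exports.
Local Open Scope ring_scope.

Section Euclidean3.
Variable R : realType.
Implicit Types u v : 'rV[R]_3.

Definition dotmul u v : R := \sum_(i < 3) u 0 i * v 0 i.

(* The norm `|u| of the library on 'rV[R]_3 is the sup norm. *)
Definition enorm u : R := Num.sqrt (dotmul u u).

(* Indices are added in 'I_3, i.e. modulo 3, so that the coordinate k = 0 is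
   u_1 v_2 - u_2 v_1, and so on cyclically. *)
Definition crossmul u v : 'rV[R]_3 :=
  \row_(k < 3) (u 0 (k + 1) * v 0 (k + 2) - u 0 (k + 2) * v 0 (k + 1)).

(* derive1 is total, hence the two differentiability clauses. *)
Definition is_cauchy_solution (w : 'rV[R]_3) (omega0 : R) (r0 v0 : 'rV[R]_3)
    (r : R -> 'rV[R]_3) : Prop :=
  [/\ forall t, derivable r t 1,
      forall t, derivable (derive1 r) t 1,
      forall t,
        derive1n 2 r t + 2 *: crossmul w (derive1 r t) + omega0 ^+ 2 *: r t = 0,
      r 0 = r0 &
      derive1 r 0 = v0].

(* psi_0 is psi w omega0 r0 v0 and psi_* is psi w omegas r0 v0. *)
Definition psi (w : 'rV[R]_3) (nu : R) (r0 v0 : 'rV[R]_3) (t : R) : 'rV[R]_3 :=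
  cos (nu * t) *: r0 + (sin (nu * t) / nu) *: (v0 + crossmul w r0).

End Euclidean3.

(* Main.v *)
From HB Require Import structures.
Require Import Defs.
From mathcomp Require Import all_boot all_order all_algebra.
From mathcomp Require Import all_classical all_reals all_analysis.
From mathcomp Require Import ring.
Import Order.TTheory GRing.Theory Num.Theory.
Import numFieldNormedType.Exports.
Local Open Scope ring_scope.

(** The equation is that of an isotropic oscillator subject to the Coriolis term
    [2 w x r'].  Split space into the axis of [w] and the plane orthogonal to
    it.  On the axis this term vanishes, and the motion
    is harmonic with frequency [omega0].  In the plane, passing to a frame that
    turns at the rate [- omega] about [w] removes the first-order term and adds
    [omega ^+ 2] to the stiffness, so the motion there is harmonic with
    frequency [omegas].  This suggests

      [r t = axial omega (psi_0 t) + gyration omega t (psi_* t)],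

    where [axial] is the projection on the axis and [gyration omega t] is the
    projection on the plane followed by the rotation of angle [- omega * t].
    All that is needed about the rotation is its product rule
    [is_derive_gyration], with the correction [- w x gyration omega t (f t)],
    and the fact that [w x _] squares to [- omega ^+ 2] on the plane
    ([crossmul2_gyration]); the check of the equation is then linear algebra
    ([rotating_frame_residual]).  The initial velocity of both [psi] is
    [v0 + w x r0] because the rotating frame contributes [- w x r0] at time 0.

    Conversely, the difference [d] of two solutions conserves the energy
    [|d'|^2 + omega0^2 |d|^2], since the gyroscopic force [- 2 w x d'] is
    orthogonal to [d'].  This energy is 0 at time 0, hence always, and
    [omega0 > 0] forces [d = 0] ([cauchy_solution_uniq]). *)

Set Implicit Arguments.
Unset Strict Implicit.

(** * Derivatives of vector-valued functions of a real variable *)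

Section Calculus.
Variable R : realType.

Lemma is_derive_rowP n (f : R -> 'rV[R]_n) (t : R) (df : 'rV[R]_n) :
  is_derive t 1 f df <-> forall i, is_derive t 1 (fun x => f x 0 i) (df 0 i).
Proof.
split=> [[fd <-] i|fd].
  rewrite derive_mx // mxE.
  by apply: derivableP; move/derivable_mxP: fd; exact.
have fd' : derivable f t 1.
  by apply/derivable_mxP => i j; rewrite ord1; exact: ex_derive.
apply: DeriveDef => //; rewrite derive_mx //.
by apply/rowP => i; rewrite mxE derive_val.
Qed.

(** A linear map between finite-dimensional spaces is given by a matrix, so each
    coordinate of [L (f x)] is a fixed combination of those of [f x]. *)
Lemma is_derive_linear m n (L : {linear 'rV[R]_m -> 'rV[R]_n})
    (f : R -> 'rV[R]_m) (t : R) (df : 'rV[R]_m) :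
  is_derive t 1 f df -> is_derive t 1 (fun x => L (f x)) (L df).
Proof.
move=> /is_derive_rowP fd; apply/is_derive_rowP => j.
have LE u : L u 0 j = \sum_(i < m) lin1_mx L i j * u 0 i.
  by rewrite -mul_rV_lin1 mxE; apply: eq_bigr => i _; rewrite mulrC.
rewrite LE.
have -> : (fun x => L (f x) 0 j) =
    \sum_(i < m) (fun x => lin1_mx L i j *: (f x 0 i : R^o)).
  by apply/funext => x; rewrite LE fct_sumE.
by apply: is_derive_sum => i; apply: is_deriveZ.
Qed.

Lemma is_derive_scale n (k : R -> R) (f : R -> 'rV[R]_n) (t dk : R) df :
  is_derive t 1 k dk -> is_derive t 1 f df ->
  is_derive t 1 (fun x => k x *: f x) (k t *: df + dk *: f t).
Proof.
move=> kd /is_derive_rowP fd; apply/is_derive_rowP => i; rewrite !mxE.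
have -> : (fun x => (k x *: f x) 0 i) = k * (fun x => f x 0 i).
  by apply/funext => x; rewrite mxE.
by apply: is_derive_eq; rewrite /GRing.scale /= [dk * _]mulrC.
Qed.

Lemma is_derive_scale_cst n (k : R -> R) (c : 'rV[R]_n) (t dk : R) :
  is_derive t 1 k dk -> is_derive t 1 (fun x => k x *: c) (dk *: c).
Proof.
move=> kd; have cd := is_derive_cst c t (1 : R).
by apply: is_derive_eq (is_derive_scale kd cd) _; rewrite scaler0 add0r.
Qed.

Lemma is_derive_dotmul (f g : R -> 'rV[R]_3) (t : R) df dg :
  is_derive t 1 f df -> is_derive t 1 g dg ->
  is_derive t 1 (fun x => dotmul (f x) (g x))
    (dotmul df (g t) + dotmul (f t) dg).
Proof.
move=> /is_derive_rowP fd /is_derive_rowP gd.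
have -> : (fun x => dotmul (f x) (g x)) =
    \sum_(i < 3) ((fun x => f x 0 i) * (fun x => g x 0 i)).
  by apply/funext => x; rewrite fct_sumE.
apply: is_derive_eq; rewrite -big_split /=; apply: eq_bigr => i _.
by rewrite addrC; congr (_ + _); rewrite /GRing.scale /= mulrC.
Qed.

Lemma is_derive_sinM (nu t : R) :
  is_derive t 1 (fun x => sin (nu * x)) (nu * cos (nu * t)).
Proof.
have h : is_derive t (1 : R) ( *%R nu) nu.
  by apply: is_derive_eq; rewrite /GRing.scale /= mulr1.
rewrite mulrC; exact: (is_derive1_comp (f := @sin R)).
Qed.

Lemma is_derive_cosM (nu t : R) :
  is_derive t 1 (fun x => cos (nu * x)) (- nu * sin (nu * t)).
Proof.
have h : is_derive t (1 : R) ( *%R nu) nu.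
  by apply: is_derive_eq; rewrite /GRing.scale /= mulr1.
rewrite mulNr mulrC -mulNr; exact: (is_derive1_comp (f := @cos R)).
Qed.

Lemma is_derive_sinM_div (nu t : R) : nu != 0 ->
  is_derive t 1 (fun x => sin (nu * x) / nu) (cos (nu * t)).
Proof.
move=> nu0; have := is_deriveZ nu^-1 (is_derive_sinM nu t).
rewrite /GRing.scale /= mulKf //.
by congr is_derive; apply/funext => x; rewrite mulrC.
Qed.

End Calculus.

(** * Scalar and cross products *)

Section Algebra.
Variable R : realType.
Implicit Types w x y : 'rV[R]_3.

Lemma crossmul_is_linear w : linear (crossmul w).
Proof. by move=> a x y; apply/rowP => k; rewrite !mxE; ring. Qed.

HB.instance Definition _ w :=
  GRing.isLinear.Build R 'rV[R]_3 'rV[R]_3 _ (crossmul w)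
    (crossmul_is_linear w).

Lemma dotmul_is_linear w : scalar (dotmul w).
Proof.
by move=> a x y; rewrite /dotmul !big_ord_recr !big_ord0 /= !mxE; ring.
Qed.

HB.instance Definition _ w :=
  GRing.isLinear.Build R 'rV[R]_3 R _ (dotmul w) (dotmul_is_linear w).

Lemma dotmulC x y : dotmul x y = dotmul y x.
Proof. by apply: eq_bigr => i _; rewrite mulrC. Qed.

Lemma dotmul_ge0 x : 0 <= dotmul x x.
Proof. by apply: sumr_ge0 => i _; rewrite -expr2 sqr_ge0. Qed.

Lemma dotmul_eq0 x : (dotmul x x == 0) = (x == 0).
Proof.
apply/idP/eqP => [|->]; last by rewrite linear0.
rewrite psumr_eq0 => [|i _]; last by rewrite -expr2 sqr_ge0.
move=> /allP x0; apply/rowP => i; rewrite mxE; apply/eqP.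
by have := x0 i (mem_index_enum i); rewrite mulf_eq0 orbb.
Qed.

Lemma ord3E (P : 'I_3 -> Prop) : P 0 -> P 1 -> P 2 -> forall i, P i.
Proof.
move=> P0 P1 P2 [[|[|[|//]]] h]; [move: P0|move: P1|move: P2];
  by congr P; apply: val_inj.
Qed.

Lemma sum3E (F : 'I_3 -> R) : \sum_(i < 3) F i = F 0 + F 1 + F 2.
Proof.
rewrite !big_ord_recr big_ord0 /= add0r.
by congr (F _ + F _ + F _); apply: val_inj.
Qed.

(** Addition in ['I_3] is modulo 3; this table reduces the indices that occur in
    [crossmul]. *)
Lemma ord3D : ((0 : 'I_3) + 1 = 1) * ((0 : 'I_3) + 2 = 2) *
  ((1 : 'I_3) + 1 = 2) * ((1 : 'I_3) + 2 = 0) *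
  ((2 : 'I_3) + 1 = 0) * ((2 : 'I_3) + 2 = 1).
Proof. by do !split; apply: val_inj. Qed.

Lemma dotmul_crossl w x : dotmul w (crossmul w x) = 0.
Proof. by rewrite /dotmul sum3E !mxE !ord3D; ring. Qed.

Lemma dotmul_crossr w x : dotmul x (crossmul w x) = 0.
Proof. by rewrite /dotmul sum3E !mxE !ord3D; ring. Qed.

Lemma crossmulxx w : crossmul w w = 0.
Proof. by apply/rowP => k; rewrite !mxE mulrC subrr. Qed.

Lemma crossmul2E w x :
  crossmul w (crossmul w x) = dotmul w x *: w - dotmul w w *: x.
Proof.
by apply/rowP; apply: ord3E; rewrite /dotmul !sum3E !mxE !ord3D; ring.
Qed.

End Algebra.

(** * The Cauchy problem and its uniqueness *)

Section Dynamics.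
Variable R : realType.
Variable w : 'rV[R]_3.
Implicit Types (omega nu t : R) (x y c r v : 'rV[R]_3).

Lemma cauchy_solutionI omega0 r0 v0 (r v a : R -> 'rV[R]_3) :
  (forall t, is_derive t 1 r (v t)) -> (forall t, is_derive t 1 v (a t)) ->
  (forall t, a t + 2 *: crossmul w (v t) + omega0 ^+ 2 *: r t = 0) ->
  r 0 = r0 -> v 0 = v0 -> is_cauchy_solution w omega0 r0 v0 r.
Proof.
move=> dr dv eq ? ?.
have rE : derive1 r = v by apply/funext => t; rewrite derive1E derive_val.
split=> [t|t|t||]; rewrite ?derive1nS ?derive1n1 ?rE //.
by rewrite /= derive1E derive_val eq.
Qed.

Lemma residual_sub (k l : R) x y c v (a b : 'rV[R]_3) :
  a + k *: c + l *: x = 0 -> b + k *: v + l *: y = 0 ->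
  a - b = - (k *: (c - v)) - l *: (x - y).
Proof.
move=> /(canRL (addrK _))/(canRL (addrK _)) ->.
move=> /(canRL (addrK _))/(canRL (addrK _)) ->.
by apply/rowP => i; rewrite !mxE; ring.
Qed.

(** The Coriolis term does no work: [e t] is orthogonal to [w x e t]. *)
Lemma energy_conserved k (d e f : R -> 'rV[R]_3) t :
  is_derive t 1 d (e t) -> is_derive t 1 e (f t) ->
  f t = - (2 *: crossmul w (e t)) - k *: d t ->
  is_derive t 1
    (fun s => dotmul (e s) (e s) + k * dotmul (d s) (d s)) 0.
Proof.
move=> dd de ft.
have De := is_derive_dotmul de de; have Dd := is_derive_dotmul dd dd.
apply: is_derive_eq (is_deriveD De (is_deriveZ k Dd)) _.
rewrite [dotmul (f t) _]dotmulC [dotmul (d t) _]dotmulC ft.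
by rewrite linearB linearN !linearZ /= dotmul_crossr /GRing.scale /=; ring.
Qed.

Lemma homogeneous_eq0 k (d e f : R -> 'rV[R]_3) : 0 < k ->
  (forall t, is_derive t 1 d (e t)) -> (forall t, is_derive t 1 e (f t)) ->
  (forall t, f t = - (2 *: crossmul w (e t)) - k *: d t) ->
  d 0 = 0 -> e 0 = 0 -> forall t, d t = 0.
Proof.
move=> k0 dd de ft d0 e0 t.
have := is_derive_0_is_cst t 0 (fun s => energy_conserved (dd s) (de s) (ft s)).
rewrite /= d0 e0 !linear0 mulr0 addr0 => /eqP.
rewrite paddr_eq0 ?dotmul_ge0 // => [/andP[_]|]; last first.
  by apply: mulr_ge0; [exact: ltW|exact: dotmul_ge0].
by rewrite mulf_eq0 gt_eqF //= dotmul_eq0 => /eqP.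
Qed.

(** The equation is linear, so the difference of two solutions solves the
    homogeneous problem with zero initial data. *)
Lemma cauchy_solution_uniq omega0 r0 v0 (r s : R -> 'rV[R]_3) : 0 < omega0 ->
  is_cauchy_solution w omega0 r0 v0 r -> is_cauchy_solution w omega0 r0 v0 s ->
  r = s.
Proof.
move=> om0 [dr ddr eqr r00 v00] [ds dds eqs s00 u00].
have D (f : R -> 'rV[R]_3) (df : forall t, derivable f t 1) t :
    is_derive t 1 f (derive1 f t).
  by rewrite derive1E; exact: derivableP.
apply/funext => t; apply/eqP; rewrite -subr_eq0; apply/eqP.
apply: (homogeneous_eq0 (exprn_gt0 2 om0)
  (fun t => is_deriveB (D _ dr t) (D _ ds t))
  (fun t => is_deriveB (D _ ddr t) (D _ dds t))) => [x||].
- rewrite (linearB (crossmul w)); exact: residual_sub (eqr x) (eqs x).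
- by rewrite !fctE r00 s00 subrr.
- by rewrite v00 u00 subrr.
Qed.

(** * The explicit motion *)

Definition psi_deriv nu r0 v0 t : 'rV[R]_3 :=
  (- nu * sin (nu * t)) *: r0 + cos (nu * t) *: (v0 + crossmul w r0).

Lemma is_derive_psi nu r0 v0 t : nu != 0 ->
  is_derive t 1 (psi w nu r0 v0) (psi_deriv nu r0 v0 t).
Proof.
move=> nu0; apply: is_deriveD; apply: is_derive_scale_cst.
  exact: is_derive_cosM.
exact: is_derive_sinM_div.
Qed.

Lemma is_derive_psi_deriv nu r0 v0 t : nu != 0 ->
  is_derive t 1 (psi_deriv nu r0 v0) (- nu ^+ 2 *: psi w nu r0 v0 t).
Proof.
move=> nu0.
have -> : - nu ^+ 2 *: psi w nu r0 v0 t =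
  (- nu * (nu * cos (nu * t))) *: r0 +
  (- nu * sin (nu * t)) *: (v0 + crossmul w r0).
  rewrite scalerDr !scalerA; congr (_ *: _ + _ *: _); first by ring.
  by field.
apply: is_deriveD; apply: is_derive_scale_cst; last exact: is_derive_cosM.
exact: (is_deriveZ (- nu) (is_derive_sinM nu t)).
Qed.

(** When [omega] is the length of [w], this is the orthogonal projection on the
    line spanned by [w]. *)
Definition axial omega x := (dotmul w x / omega ^+ 2) *: w.

(** When [omega] is the length of [w], this is the orthogonal projection on the
    plane normal to [w], namely [- w x (w x _) / omega ^+ 2], followed by the
    rotation of angle [- omega * t] about [w], since [w x _ / omega] is the
    quarter turn of that plane. *)
Definition gyration omega t x :=
  - ((sin (omega * t) / omega) *: crossmul w x)
  - (cos (omega * t) / omega ^+ 2) *: crossmul w (crossmul w x).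

Lemma axial_is_linear omega : linear (axial omega).
Proof.
by move=> k x y; rewrite /axial linearP /= scalerA -scalerDl /GRing.scale /=;
  congr (_ *: _); ring.
Qed.

HB.instance Definition _ omega :=
  GRing.isLinear.Build R 'rV[R]_3 'rV[R]_3 _ (axial omega)
    (axial_is_linear omega).

Lemma gyration_is_linear omega t : linear (gyration omega t).
Proof.
move=> k x y; rewrite /gyration !linearP /=.
move: (crossmul w (crossmul w x)) (crossmul w (crossmul w y)) => x2 y2.
move: (crossmul w x) (crossmul w y) => x1 y1.
by apply/rowP => i; rewrite !mxE; ring.
Qed.

HB.instance Definition _ omega t :=
  GRing.isLinear.Build R 'rV[R]_3 'rV[R]_3 _ (gyration omega t)
    (gyration_is_linear omega t).

Lemma crossmul_axial omega x : crossmul w (axial omega x) = 0.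
Proof. by rewrite linearZ /= crossmulxx scaler0. Qed.

Lemma crossmul3 omega x : omega ^+ 2 = dotmul w w ->
  crossmul w (crossmul w (crossmul w x)) = - omega ^+ 2 *: crossmul w x.
Proof.
by move=> ->; rewrite [LHS]crossmul2E dotmul_crossl scale0r sub0r scaleNr.
Qed.

(** The range of [gyration omega t] lies in the plane normal to [w], where
    [w x _ / omega] is a quarter turn. *)
Lemma crossmul2_gyration omega t x : omega ^+ 2 = dotmul w w ->
  crossmul w (crossmul w (gyration omega t x)) =
  - omega ^+ 2 *: gyration omega t x.
Proof.
move=> om2; rewrite /gyration; move: (_ / omega) (_ / omega ^+ 2) => k l.
rewrite !(linearB (crossmul w)) !(linearN (crossmul w)).
rewrite !(linearZ_LR (crossmul w)) /= !(crossmul3 _ om2).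
move: (crossmul w (crossmul w x)) (crossmul w x) => x2 x1.
by apply/rowP => i; rewrite !mxE; ring.
Qed.

(** The rotation of angle [- omega * t] about [w] satisfies [G' = - w x G], which
    gives the second term of the product rule. *)
Lemma is_derive_gyration omega (f : R -> 'rV[R]_3) df t :
  omega != 0 -> omega ^+ 2 = dotmul w w ->
  is_derive t 1 f df ->
  is_derive t 1 (fun s => gyration omega s (f s))
    (gyration omega t df - crossmul w (gyration omega t (f t))).
Proof.
move=> om0 om2 fd.
have d1 := is_derive_linear (crossmul w) fd.
have d2 := is_derive_linear (crossmul w) d1.
have ds := is_derive_sinM_div t om0.
have dc : is_derive t 1 (fun s => cos (omega * s) / omega ^+ 2)
    (- sin (omega * t) / omega).
  have := is_deriveZ (omega ^- 2) (is_derive_cosM omega t).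
  congr is_derive; first by apply/funext => x; rewrite mulrC.
  by rewrite /GRing.scale /=; field.
apply: is_derive_eq
  (is_deriveB (is_deriveN (is_derive_scale ds d1)) (is_derive_scale dc d2)) _.
rewrite /gyration (linearB (crossmul w)) (linearN (crossmul w)).
rewrite !(linearZ_LR (crossmul w)) /= (crossmul3 _ om2).
move: (crossmul w (crossmul w df)) (crossmul w (crossmul w (f t))) => x2 y2.
move: (crossmul w df) (crossmul w (f t)) => x1 y1.
by apply/rowP => i; rewrite !mxE; field.
Qed.

Lemma axialD_gyration0 omega x : omega != 0 -> omega ^+ 2 = dotmul w w ->
  axial omega x + gyration omega 0 x = x.
Proof.
move=> om0 om2; rewrite /gyration /axial mulr0 sin0 cos0 crossmul2E -om2.
rewrite mul0r scale0r oppr0 add0r.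
by apply/rowP => i; rewrite !mxE; field.
Qed.

(** Left side of the equation of motion, with [a], [a1] the axial parts of [psi_0]
    and of its derivative, [g], [g1] the rotated planar parts of [psi_*] and of
    its derivative, and [k = omega0 ^+ 2], [l = omega ^+ 2].  The terms
    [w x g1] cancel: two come from the second derivative of the rotation, two
    from the Coriolis force.  What multiplies [g] is
    [- (l + k) - l + 2 l + k = 0]. *)
Lemma rotating_frame_residual (k l : R) (a a1 g g1 : 'rV[R]_3) :
  crossmul w a1 = 0 -> crossmul w (crossmul w g) = - l *: g ->
  - k *: a + (- (l + k) *: g - crossmul w g1 - crossmul w (g1 - crossmul w g))
  + 2 *: crossmul w (a1 + (g1 - crossmul w g)) + k *: (a + g) = 0.
Proof.
move=> a1_axial g_perp.
rewrite !(linearD (crossmul w)) !(linearN (crossmul w)) /= a1_axial g_perp.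
move: (crossmul w g1) => b.
by apply/rowP => i; rewrite !mxE; ring.
Qed.

(** At time 0, [axial] and [gyration] add up to the identity, so the position is
    [r0] and the velocity is [(v0 + w x r0) - w x r0]. *)
Lemma motion_is_cauchy_solution omega omega0 omegas r0 v0 :
  omega != 0 -> omega ^+ 2 = dotmul w w -> omega0 != 0 -> omegas != 0 ->
  omegas ^+ 2 = omega ^+ 2 + omega0 ^+ 2 ->
  is_cauchy_solution w omega0 r0 v0
    (fun t => axial omega (psi w omega0 r0 v0 t) +
              gyration omega t (psi w omegas r0 v0 t)).
Proof.
move=> om0 om2 o0 os os2.
have dps t := is_derive_psi r0 v0 t os; have dp0 t := is_derive_psi r0 v0 t o0.
have ddps t := is_derive_psi_deriv r0 v0 t os.
have ddp0 t := is_derive_psi_deriv r0 v0 t o0.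
have psi0 nu : psi w nu r0 v0 0 = r0.
  by rewrite /psi mulr0 cos0 sin0 mul0r scale0r addr0 scale1r.
have dpsi0 nu : psi_deriv nu r0 v0 0 = v0 + crossmul w r0.
  by rewrite /psi_deriv mulr0 cos0 sin0 mulr0 scale0r add0r scale1r.
have dG t := is_derive_gyration om0 om2 (dps t).
have dGs t := is_derive_gyration om0 om2 (ddps t).
have dr t := is_deriveD (is_derive_linear (axial omega) (dp0 t)) (dG t).
have dv t := is_deriveD (is_derive_linear (axial omega) (ddp0 t))
  (is_deriveB (dGs t) (is_derive_linear (crossmul w) (dG t))).
apply: (cauchy_solutionI dr dv) => [t||].
- rewrite (linearZ_LR (axial omega)) (linearZ_LR (gyration omega t)) os2.
  apply: rotating_frame_residual; first exact: crossmul_axial.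
  exact: crossmul2_gyration.
- by rewrite fctE !psi0 axialD_gyration0.
- rewrite !dpsi0 !psi0 addrA axialD_gyration0 //.
  have := linearD (crossmul w) (axial omega r0) (gyration omega 0 r0).
  by rewrite /= axialD_gyration0 // crossmul_axial add0r => ->; rewrite addrK.
Qed.

End Dynamics.

Unset Implicit Arguments.
Set Strict Implicit.

(** * Solution of the Cauchy problem *)

Theorem mainTheorem15 (R : realType) (w : 'rV[R]_3) (omega omega0 omegas : R)
    (r0 v0 : 'rV[R]_3)
    (hw : w != 0) (homega : omega = enorm w) (homega0 : 0 < omega0)
    (homegas : 0 < omegas) (homegas2 : omegas ^+ 2 = omega ^+ 2 + omega0 ^+ 2)
    (r : R -> 'rV[R]_3) :
  is_cauchy_solution w omega0 r0 v0 r <->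
  forall t : R,
    r t = (dotmul w (psi w omega0 r0 v0 t) / omega ^+ 2) *: w
        - (sin (omega * t) / omega) *: crossmul w (psi w omegas r0 v0 t)
        - (cos (omega * t) / omega ^+ 2) *:
            crossmul w (crossmul w (psi w omegas r0 v0 t)).
Proof.
have om2 : omega ^+ 2 = dotmul w w by rewrite homega sqr_sqrtr ?dotmul_ge0.
have om0 : omega != 0 by rewrite -sqrf_eq0 om2 dotmul_eq0.
have sol := motion_is_cauchy_solution r0 v0 om0 om2 (lt0r_neq0 homega0)
  (lt0r_neq0 homegas) homegas2.
split=> [rsol t|rE].
  by rewrite (cauchy_solution_uniq homega0 rsol sol) addrA.
suff -> : r = (fun t => axial w omega (psi w omega0 r0 v0 t) +
              gyration w omega t (psi w omegas r0 v0 t)) by [].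
by apply/funext => t; rewrite rE addrA.
Qed.
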